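(* Let $(G,s,t)$ be a Shannon game and let $\{a,b\}$ be a short-cut in it, where $b$ is a vertex of degree 2 adjacent to one terminal and at distance 2 from the other terminal, and $a$ is the other vertex of the pair. Suppose that one of the following holds: (i) $(G,s,t)$ is a minimal weak link or a minimal strong link (with either player to move first); (ii) $(G,s,t)$ is a weak link and Short moves first; (iii) one of the two players has a winning strategy for $(G,s,t)$ as second player. Then shorting $a$ and cutting $b$ (with the same player to move next as in the original game) does not change which player wins.
   Context: A Shannon game (link) $(G,s,t)$ consists of a finite simple graph $G$ and two distinct designated vertices $s,t$, the terminals. Two players, Short and Cut, alternately select a not-yet-selected non-terminal vertex; Short claims (''shorts'') his vertices, Cut deletes (''cuts'') his. Shorting $v$ is equivalent to deleting $v$ and making all pairs of former neighbours of $v$ adjacent; cutting $v$ is deleting $v$. Short wins if at the end there is an $s$–$t$ path all of whose internal vertices are claimed by Short; otherwise Cut wins. The link is strong if Short has a winning strategy when moving second, and weak if Short has a winning strategy when moving first but not when moving second. A weak link is minimal if deleting any single edge produces a game in which Short has no winning strategy as first player; a strong link is minimal if deleting any single edge produces a game that is not a strong link. A short-cut is a pair of adjacent non-terminal vertices, one of which has degree 2, is adjacent to one terminal and is at distance 2 from the other terminal. (When both vertices of the short-cut have degree 2 and satisfy this condition, either may play the role of $b$.) *)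

(* Defs.v *)
From mathcomp Require Import all_boot.

Set Implicit Arguments.
Unset Strict Implicit.
Unset Printing Implicit Defensive.

(* The vertex set is a subset of an ambient finite type, so that deleting a
   vertex does not change the type of the remaining ones. *)
Record sgraph (V : finType) := SGraph {
  verts : {set V};
  adj : rel V;
  adj_sym : symmetric adj;
  adj_irr : irreflexive adj;
  adj_verts : forall x y, adj x y -> x \in verts }.

Section GraphOperations.
Variables (V : finType) (G : sgraph V).
Implicit Types (v x y : V) (n : nat).

Definition degree v : nat := #|[set x in verts G | adj G v x]|.

Definition walk_of_length x y n : Prop :=
  exists q : seq V, [/\ path (adj G) x q, last x q = y & size q = n].

Definition at_distance x y n : Prop :=
  walk_of_length x y n /\ forall m, walk_of_length x y m -> n <= m.

Definition del_edge_adj (x y : V) : rel V :=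
  [rel u w | adj G u w && ([set u; w] != [set x; y])].

Lemma del_edge_sym x y : symmetric (del_edge_adj x y).
Proof. by move=> u w; rewrite /del_edge_adj /= adj_sym setUC. Qed.

Lemma del_edge_irr x y : irreflexive (del_edge_adj x y).
Proof. by move=> u; rewrite /del_edge_adj /= adj_irr. Qed.

Lemma del_edge_verts x y u w : del_edge_adj x y u w -> u \in verts G.
Proof. by case/andP=> /adj_verts. Qed.

Definition del_edge x y : sgraph V :=
  SGraph (@del_edge_sym x y) (@del_edge_irr x y) (@del_edge_verts x y).

Definition cut_adj v : rel V := [rel x y | [&& x != v, y != v & adj G x y]].

Lemma cut_sym v : symmetric (cut_adj v).
Proof. by move=> x y; rewrite /cut_adj /= adj_sym andbCA. Qed.

Lemma cut_irr v : irreflexive (cut_adj v).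
Proof. by move=> x; rewrite /cut_adj /= adj_irr !andbF. Qed.

Lemma cut_verts v x y : cut_adj v x y -> x \in verts G :\ v.
Proof. by case/and3P=> xv _ /adj_verts xG; rewrite in_setD1 xv. Qed.

Definition cut_vertex v : sgraph V :=
  SGraph (@cut_sym v) (@cut_irr v) (@cut_verts v).

Definition short_adj v : rel V :=
  [rel x y | [&& x != v, y != v, x != y
               & adj G x y || adj G v x && adj G v y]].

Lemma short_sym v : symmetric (short_adj v).
Proof.
move=> x y; rewrite /short_adj /= adj_sym andbCA (eq_sym x y).
by rewrite (andbC (adj G v x)).
Qed.

Lemma short_irr v : irreflexive (short_adj v).
Proof. by move=> x; rewrite /short_adj /= eqxx !andbF. Qed.

Lemma short_verts v x y : short_adj v x y -> x \in verts G :\ v.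
Proof.
case/and4P=> xv _ _; rewrite in_setD1 xv /=.
by case/orP=> [/adj_verts // | /andP[]]; rewrite adj_sym => /adj_verts.
Qed.

Definition short_vertex v : sgraph V :=
  SGraph (@short_sym v) (@short_irr v) (@short_verts v).

End GraphOperations.

Inductive player := Short | Cut.

Definition opponent (P : player) : player :=
  match P with Short => Cut | Cut => Short end.

(* The player who makes move number k (counted from 0) when f moves first. *)
Definition turn (f : player) (k : nat) : player :=
  if odd k then opponent f else f.

Section ShannonGame.
Variables (V : finType) (G : sgraph V) (s t : V).
Implicit Types (f P : player) (h : seq V) (sigma : seq V -> V).

Definition shannon_game : Prop :=
  [/\ s \in verts G, t \in verts G & s != t].

Definition nonterminals : {set V} := verts G :\: [set s; t].

(* A history lists the vertices selected so far, in order of selection. *)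
Definition history h : Prop := uniq h /\ {subset h <= nonterminals}.

Definition unselected h : {set V} := nonterminals :\: [set x in h].

Definition complete h : Prop := history h /\ unselected h = set0.

Definition shorted f h : {set V} :=
  [set x in h | if turn f (index x h) is Short then true else false].

Definition short_connects f h : Prop :=
  exists q : seq V,
    [/\ path (adj G) s (rcons q t), uniq (s :: rcons q t)
      & {subset q <= shorted f h}].

Definition won_by f P h : Prop :=
  match P with
  | Short => short_connects f h
  | Cut => ~ short_connects f h
  end.

(* sigma maps every history after which P is to move to P's next vertex. *)
Definition legal_strategy f P sigma : Prop :=
  forall h, history h -> unselected h <> set0 -> turn f (size h) = P ->
    sigma h \in unselected h.

Definition follows f P sigma h : Prop :=
  forall h1 x h2, h = h1 ++ x :: h2 -> turn f (size h1) = P -> x = sigma h1.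

Definition winning_strategy f P sigma : Prop :=
  legal_strategy f P sigma /\
  forall h, complete h -> follows f P sigma h -> won_by f P h.

(* P can force a win when f makes the first move. *)
Definition wins f P : Prop := exists sigma, winning_strategy f P sigma.

Definition strong_link : Prop := wins Cut Short.

Definition weak_link : Prop := wins Short Short /\ ~ wins Cut Short.

(* The pair is ordered: b is the vertex of degree 2. *)
Definition short_cut (a b : V) : Prop :=
  [/\ a \in nonterminals, b \in nonterminals, adj G a b, degree G b = 2
    & (adj G b s /\ at_distance G b t 2) \/ (adj G b t /\ at_distance G b s 2)].

End ShannonGame.

Definition minimal_weak_link (V : finType) (G : sgraph V) (s t : V) : Prop :=
  weak_link G s t /\
  forall x y, adj G x y -> ~ wins (del_edge G x y) s t Short Short.

Definition minimal_strong_link (V : finType) (G : sgraph V) (s t : V) : Prop :=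
  strong_link G s t /\
  forall x y, adj G x y -> ~ strong_link (del_edge G x y) s t.

(* Main.v *)
(* If Short takes a, Cut has to answer b, and if Short takes b, Cut has to answer
   a; in the second case b ends up useless.  Pairing a with b therefore turns any
   win of Cut after the reduction into a win of Cut before it.  Conversely, when
   Short moves first he can open with a, which forces b and reaches the reduced
   game with Short to move again.  The only remaining case is a weak link with
   Cut moving first whose reduction is strong: then Short, moving first, wins by
   taking a even without the edge from b to its terminal, so the link is not
   minimal. *)
Require Import Defs.
From mathcomp Require Import all_boot.

Set Implicit Arguments.
Unset Strict Implicit.
Unset Printing Implicit Defensive.

Lemma set_proper_ind (V : finType) (Q : {set V} -> Prop) :
  (forall U : {set V}, (forall U' : {set V}, U' \proper U -> Q U') -> Q U) ->
  forall U, Q U.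
Proof.
move=> IH U; have [n] := ubnP #|U|; elim: n U => // n IHn U ltUn.
apply: IH => U' /proper_card ltU'; apply: IHn.
exact: leq_trans ltU' _.
Qed.

(** The target is [connect e'] rather than [e'] so that [r] may collapse an edge to a point or
    stretch it to a walk; the retractions of [a] and of [b] below collapse edges. *)
Lemma connect_map (V : finType) (e e' : rel V) (r : V -> V) x y :
  (forall u v, e u v -> connect e' (r u) (r v)) ->
  connect e x y -> connect e' (r x) (r y).
Proof.
move=> er /connectP[p + ->]; elim: p x => //= z p IHp x /andP[/er exz /IHp].
exact: connect_trans.
Qed.

(** * Positions of the selection game and their values by backward induction *)

Section PositionGame.
Variables (V : finType).
Implicit Types (W : pred {set V}) (p : player) (U S T : {set V}) (x y : V).

Fixpoint short_wins_in W n p U S : bool :=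
  if n is n'.+1 then
    match p with
    | Short => [exists x in U, short_wins_in W n' Cut (U :\ x) (x |: S)]
    | Cut => [forall x in U, short_wins_in W n' Short (U :\ x) S]
    end
  else W S.

(* U is the set of free vertices and S the set of vertices shorted so far; Short
   wins if W holds for the shorted vertices at the end. *)
Definition short_wins W p U S : bool := short_wins_in W #|U| p U S.

Lemma short_wins0 W p S : short_wins W p set0 S = W S.
Proof. by rewrite /short_wins cards0. Qed.

Lemma short_wins_ShortP W U S :
  U != set0 ->
  reflect (exists2 x, x \in U & short_wins W Cut (U :\ x) (x |: S))
          (short_wins W Short U S).
Proof.
rewrite /short_wins -card_gt0; case defn: #|U| => [|n] //= _.
have cardD x : x \in U -> n = #|U :\ x|.
  by move=> xU; move: defn; rewrite (cardsD1 x) xU => -[].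
apply: (iffP exists_inP) => -[x xU xw]; exists x => //.
  by rewrite -cardD.
by rewrite (cardD x).
Qed.

Lemma short_wins_CutP W U S :
  U != set0 ->
  reflect (forall x, x \in U -> short_wins W Short (U :\ x) S)
          (short_wins W Cut U S).
Proof.
rewrite /short_wins -card_gt0; case defn: #|U| => [|n] //= _.
have cardD x : x \in U -> n = #|U :\ x|.
  by move=> xU; move: defn; rewrite (cardsD1 x) xU => -[].
by apply: (iffP forall_inP) => w x xU; move: (w x xU); rewrite -(cardD x).
Qed.

Lemma short_wins_take W U S x :
  x \in U -> short_wins W Cut (U :\ x) (x |: S) -> short_wins W Short U S.
Proof.
move=> xU w; apply/short_wins_ShortP; last by exists x.
by apply/set0Pn; exists x.
Qed.

Lemma short_wins_cut W U S x :
  x \in U -> short_wins W Cut U S -> short_wins W Short (U :\ x) S.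
Proof.
move=> xU /short_wins_CutP; apply=> //.
by apply/set0Pn; exists x.
Qed.

(** Short plays the same moves in both games. A play adds to the shorted set some part [T] of [U],
    so the two winning conditions need comparing only on final sets [T :|: S] and [T :|: S']. *)
Lemma short_wins_sub W W' p U S S' :
  (forall T, T \subset U -> W (T :|: S) -> W' (T :|: S')) ->
  short_wins W p U S -> short_wins W' p U S'.
Proof.
elim/set_proper_ind: U p S S' => U IH p S S' sWW'.
have [U0 | U_neq0] := eqVneq U set0.
  rewrite U0 !short_wins0; have := sWW' set0 (sub0set _).
  by rewrite !set0U.
case: p => [/short_wins_ShortP[] // x xU | /short_wins_CutP w].
  move=> w; apply: (@short_wins_take _ _ _ x) => //.
  apply: IH w; first exact: properD1.
  move=> T sTU; rewrite !(setUCA T) !setUA.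
  apply: sWW'; rewrite subUset sub1set xU.
  exact: subset_trans sTU (subsetDl _ _).
apply/short_wins_CutP => // x xU.
apply: IH (w U_neq0 x xU); first exact: properD1.
by move=> T sTU; apply: sWW'; apply: subset_trans sTU (subsetDl _ _).
Qed.

Section Monotone.
Variable W : pred {set V}.
Hypothesis W_up : forall S T, S \subset T -> W S -> W T.

Lemma short_wins_won p U S : W S -> short_wins W p U S.
Proof.
elim/set_proper_ind: U p S => U IH p S wS.
have [-> | U_neq0] := eqVneq U set0; first by rewrite short_wins0.
case: p; last first.
  by apply/short_wins_CutP => // x xU; apply: IH; rewrite ?properD1.
have [x xU] := set0Pn _ U_neq0; apply: (short_wins_take xU).
by apply: IH; [rewrite properD1 | apply: W_up wS; apply: subsetUr].
Qed.

(** An extra move does no harm. Short follows his winning strategy on [U], in which [x] counts as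
    still free; when the strategy asks for [x], which he already owns, he takes any free vertex, and
    that vertex becomes the new extra one. *)
Lemma short_wins_extra_move U S x :
  x \in U -> short_wins W Cut U S -> short_wins W Cut (U :\ x) (x |: S).
Proof.
elim/set_proper_ind: U S x => U IH S x xU wU.
have [Ux0 | Ux_neq0] := eqVneq (U :\ x) set0.
  move: (short_wins_cut xU wU); rewrite Ux0 !short_wins0.
  by apply: W_up; apply: subsetUr.
apply/short_wins_CutP => // y; rewrite !inE => /andP[yx yU].
have xUy : x \in U :\ y by rewrite !inE eq_sym yx.
have Uxy : U :\ x :\ y = U :\ y :\ x by rewrite !setDDl setUC.
have/short_wins_ShortP[] := short_wins_cut yU wU.
  by apply/set0Pn; exists x.
move=> z zUy wz; have ltUyz : U :\ y :\ z \proper U.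
  exact: sub_proper_trans (subsetDl _ _) (properD1 yU).
(* Here [y] is the move of Cut and [z] the answer of the strategy. If [z] is [x], any remaining [u]
   takes over the role of the extra vertex. *)
have [zx | zx] := eqVneq z x.
  rewrite zx -Uxy in wz ltUyz; rewrite {zUy}.
  have [U0 | /set0Pn[u uU]] := eqVneq (U :\ x :\ y) set0.
    by move: wz; rewrite U0 !short_wins0.
  by apply: (short_wins_take uU); apply: IH.
apply: (@short_wins_take _ _ _ z).
  by rewrite Uxy in_setD1 zx.
rewrite Uxy setDDl (setUC [set x]) -setDDl setUCA.
by apply: IH => //; rewrite in_setD1 eq_sym zx.
Qed.

Lemma short_wins_first U S : short_wins W Cut U S -> short_wins W Short U S.
Proof.
move=> wU; have [U0 | /set0Pn[x xU]] := eqVneq U set0.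
  by move: wU; rewrite U0 !short_wins0.
exact: short_wins_take xU (short_wins_extra_move xU wU).
Qed.

(** Short ignores [b] as long as he can. If Cut spends a move on [b], Short is to move on a position
    that he wins even with Cut to move; if only [b] is left for Short, taking it is harmless. *)
Lemma short_wins_extra_vertex p U S b :
  b \notin U -> short_wins W p U S -> short_wins W p (b |: U) S.
Proof.
elim/set_proper_ind: U p S => U IH p S bU wU.
have bUx x : x \in U -> (b |: U) :\ x = b |: U :\ x.
  move=> xU; apply/setP=> z; rewrite !inE.
  case: (eqVneq z x) => //= ->; rewrite orbF.
  by apply/esym; apply: contraTF xU => /eqP->.
have bUb : (b |: U) :\ b = U by rewrite setU1K.
case: p wU => wU; last first.
  apply/short_wins_CutP; first by apply/set0Pn; exists b; rewrite setU11.
  move=> x; rewrite in_setU1 => /predU1P[-> | xU].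
    by rewrite bUb; apply: short_wins_first.
  rewrite bUx //; apply: IH; rewrite ?properD1 ?in_setD1 ?(negPf bU) ?andbF //.
  exact: short_wins_cut wU.
have [U0 | U_neq0] := eqVneq U set0.
  apply: (@short_wins_take _ _ _ b); first exact: setU11.
  move: wU; rewrite bUb U0 !short_wins0.
  by apply: W_up; apply: subsetUr.
have/short_wins_ShortP[//|x xU wx] := wU.
apply: (@short_wins_take _ _ _ x); first by rewrite in_setU1 xU orbT.
by rewrite bUx //; apply: IH; rewrite ?properD1 ?in_setD1 ?(negPf bU) ?andbF.
Qed.

End Monotone.

(** Short copies his strategy on [U] until it selects [a] or [b]. Letting Cut answer with the other
    vertex of the pair leaves exactly [U :\ a :\ b] with Short to move, and the two hypotheses
    transfer the rest of the play. *)
Lemma short_wins_pairing W W' p U S a b :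
  a \in U -> b \in U -> a != b ->
  (forall T, T \subset U :\ a :\ b -> W (T :|: (a |: S)) -> W' (T :|: S)) ->
  (forall T, T \subset U :\ a :\ b -> W (T :|: (b |: S)) -> W' (T :|: S)) ->
  short_wins W p U S -> short_wins W' p (U :\ a :\ b) S.
Proof.
elim/set_proper_ind: U p S => U IH p S aU bU ab Wa Wb.
have bUa : b \in U :\ a by rewrite in_setD1 eq_sym ab.
have aUb : a \in U :\ b by rewrite in_setD1 ab.
have Uba : U :\ b :\ a = U :\ a :\ b by rewrite !setDDl setUC.
have Ux x : U :\ x :\ a :\ b = U :\ a :\ b :\ x.
  by apply/setP=> z; rewrite !inE; do 3!case: (_ == _).
case: p => wU.
  have/short_wins_ShortP[|x xU wx] := wU; first by apply/set0Pn; exists a.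
  have [xa | xa] := eqVneq x a.
    by move: wx; rewrite xa => /(short_wins_cut bUa); apply: short_wins_sub.
  have [xb | xb] := eqVneq x b.
    move: wx; rewrite xb => /(short_wins_cut aUb); rewrite Uba.
    exact: short_wins_sub.
  apply: (@short_wins_take _ _ _ x); first by rewrite !in_setD1 xa xb.
  have sub T : T \subset U :\ x :\ a :\ b -> x |: T \subset U :\ a :\ b.
    rewrite Ux subUset sub1set !in_setD1 xa xb xU => sT.
    exact: subset_trans sT (subsetDl _ _).
  rewrite -Ux; apply: IH wx; rewrite ?properD1 ?in_setD1 //.
  - by rewrite eq_sym xa.
  - by rewrite eq_sym xb.
  - by move=> T /sub sT; have:= Wa _ sT; rewrite (setUCA [set a]) !(setUA T) !(setUC T).
  - by move=> T /sub sT; have:= Wb _ sT; rewrite (setUCA [set b]) !(setUA T) !(setUC T).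
(* Cut is to move with only the pair left: let him take [b], so that Short is forced to take [a]. *)
have [U0 | U_neq0] := eqVneq (U :\ a :\ b) set0.
  have := short_wins_cut bU wU; rewrite U0 short_wins0.
  case/short_wins_ShortP=> [|x].
    by apply/set0Pn; exists a.
  move=> xUb; have ->: x = a.
    apply/eqP; apply/negPn/negP => xa.
    have: x \in U :\ a :\ b by move: xUb; rewrite !in_setD1 xa.
    by rewrite U0 inE.
  rewrite Uba U0 short_wins0.
  by have := Wa set0 (sub0set _); rewrite !set0U.
apply/short_wins_CutP => // x; rewrite !in_setD1 => /and3P[xb xa xU].
rewrite -Ux; apply: IH (short_wins_cut xU wU); rewrite ?properD1 ?in_setD1 //.
- by rewrite eq_sym xa.
- by rewrite eq_sym xb.
- by move=> T; rewrite Ux => sT; apply: Wa; apply: subset_trans sT (subsetDl _ _).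
- by move=> T; rewrite Ux => sT; apply: Wb; apply: subset_trans sT (subsetDl _ _).
Qed.

End PositionGame.

(** * Connection of the terminals through shorted vertices *)

Section Linked.
Variables (V : finType) (G : sgraph V) (s t : V).
Implicit Types (S : {set V}) (x y : V).

Definition inner_adj S : rel V :=
  [rel x y | [&& adj G x y, x \in S :|: [set s; t] & y \in S :|: [set s; t]]].

Lemma inner_adjE S x y : inner_adj S x y =
  [&& adj G x y, x \in S :|: [set s; t] & y \in S :|: [set s; t]].
Proof. by []. Qed.

Lemma connect_inner_sym S : connect_sym (inner_adj S).
Proof.
by apply: sym_connect_sym => x y; rewrite !inner_adjE adj_sym [X in _ && X]andbC.
Qed.

(** Reachability replaces the simple path of [short_connects], so that walks can be mapped and
    concatenated without keeping them simple; [linkedP] recovers the simple path. *)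
Definition linked : pred {set V} := fun S => connect (inner_adj S) s t.

Lemma linked_up S (T : {set V}) : S \subset T -> linked S -> linked T.
Proof.
move=> sST; apply: connect_sub => x y /and3P[xy xS yS]; apply: connect1.
by rewrite inner_adjE xy !(subsetP (setSU _ sST)).
Qed.

Lemma linkedP S : s != t ->
  linked S <-> exists q, [/\ path (adj G) s (rcons q t), uniq (s :: rcons q t)
                           & {subset q <= S}].
Proof.
move=> st; split=> [/connectP[p0 pth0 deft] | [q [pth _ qS]]]; last first.
  apply/connectP; exists (rcons q t); last by rewrite last_rcons.
  apply: (@sub_in_path _ (mem (S :|: [set s; t])) (adj G)) pth.
    by move=> x y xS yS xy; apply/and3P.
  suff qI : {subset s :: rcons q t <= S :|: [set s; t]} by apply/allP.
  move=> x; rewrite inE mem_rcons inE !in_setU !in_set1.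
  by case/or3P=> [-> | -> | /qS->]; rewrite ?orbT.
move: deft; case/shortenP: pth0 => p pth Up _ deft.
case/lastP: p => [|q z] in pth Up deft *; first by rewrite deft eqxx in st.
rewrite last_rcons in deft; rewrite -{z}deft in pth Up *.
exists q; split=> //; first by apply: sub_path pth => x y /and3P[].
move=> x xq; have: x \in S :|: [set s; t].
  have path_in p z : path (inner_adj S) z p -> {subset p <= S :|: [set s; t]}.
    elim: p z => //= y p IHp z /andP[/and3P[_ _ yI] /IHp pI] v.
    by rewrite inE => /predU1P[-> | /pI].
  by apply: (path_in _ _ pth); rewrite mem_rcons inE xq orbT.
(* The path is simple, so its interior avoids both terminals and must lie in [S]. *)
move: Up; rewrite cons_uniq rcons_uniq mem_rcons inE negb_or => /and3P[/andP[_ sq] tq _].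
rewrite !inE => /or3P[// | /eqP xs | /eqP xt].
  by rewrite xs (negPf sq) in xq.
by rewrite xt (negPf tq) in xq.
Qed.

End Linked.

(** * Strategies on histories, position values and determinacy *)

Section Histories.
Variables (V : finType) (G : sgraph V) (s t : V).
Hypothesis st : s != t.
Implicit Types (f P : player) (h : seq V) (x : V) (sigma : seq V -> V).

Notation history := (history G s t).
Notation unselected := (unselected G s t).
Notation linked := (linked G s t).

Definition value f h : bool :=
  short_wins linked (turn f (size h)) (unselected h) (shorted f h).

Definition favors P (w : bool) : bool := if P is Short then w else ~~ w.

Lemma turn_rcons f h x : turn f (size (rcons h x)) = opponent (turn f (size h)).
Proof. by rewrite size_rcons /turn /=; case: odd; case: f. Qed.

Lemma unselected_rcons h x : unselected (rcons h x) = unselected h :\ x.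
Proof. by apply/setP=> y; rewrite !inE mem_rcons inE negb_or -andbA. Qed.

Lemma history_rcons h x : history (rcons h x) <-> history h /\ x \in unselected h.
Proof.
rewrite /Defs.history rcons_uniq /Defs.unselected !inE; split.
  case=> /andP[xh ->] sub; split; first split=> //.
    by move=> y yh; apply: sub; rewrite mem_rcons inE yh orbT.
  by rewrite xh; have := sub x; rewrite mem_rcons mem_head !inE; apply.
case=> -[-> sub] /andP[-> xN]; split=> // y; rewrite mem_rcons inE.
by case/predU1P=> [-> | /sub //]; rewrite !inE.
Qed.

Lemma shorted_rcons f h x : x \notin h ->
  shorted f (rcons h x) =
    if turn f (size h) is Short then x |: shorted f h else shorted f h.
Proof.
move=> xh; case fh: (turn f (size h)); apply/setP=> y; rewrite !inE mem_rcons inE.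
all: rewrite -cats1 index_cat /=; have [-> | yx] := eqVneq y x.
all: rewrite ?(negPf xh) ?eqxx ?addn0 ?fh //=.
all: by case: (boolP (y \in h)) => //= ->.
Qed.

Lemma shorted0 f : shorted f [::] = set0 :> {set V}.
Proof. by apply/setP=> y; rewrite !inE. Qed.

Lemma unselected0 : unselected [::] = nonterminals G s t.
Proof. by apply/setP=> y; rewrite !inE. Qed.

Lemma notin_unselected h x : x \in unselected h -> x \notin h.
Proof. by rewrite !inE => /andP[]. Qed.

Lemma value_complete f P h : unselected h = set0 ->
  favors P (value f h) -> won_by G s t f P h.
Proof.
move=> U0; rewrite /value U0 short_wins0.
have conn : linked (shorted f h) <-> short_connects G s t f h.
  exact: linkedP.
by case: P => /= [/conn // | /negP nl /conn/nl].
Qed.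

Lemma value_own_move f P h : unselected h != set0 -> turn f (size h) = P ->
  favors P (value f h) ->
  exists2 x, x \in unselected h & favors P (value f (rcons h x)).
Proof.
move=> U_neq0 fP; rewrite /value fP; case: P fP => fP /=.
  case/short_wins_ShortP=> // x xU w; exists x => //.
  by rewrite turn_rcons unselected_rcons shorted_rcons ?notin_unselected // fP.
move=> nw; apply/exists_inP; apply: contraR nw; rewrite negb_exists_in.
move=> /forall_inP w; apply/short_wins_CutP=> // x xU; have := w x xU.
rewrite negbK turn_rcons unselected_rcons shorted_rcons ?notin_unselected //.
by rewrite fP.
Qed.

Lemma value_other_move f P h x : x \in unselected h -> turn f (size h) <> P ->
  favors P (value f h) -> favors P (value f (rcons h x)).
Proof.
move=> xU; rewrite /value turn_rcons unselected_rcons.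
rewrite shorted_rcons ?notin_unselected //.
case: P; case: (turn f (size h)) => //= _; first exact: short_wins_cut.
by apply: contra; apply: short_wins_take.
Qed.

Lemma follows_rcons f P sigma h x : follows f P sigma (rcons h x) ->
  follows f P sigma h /\ (turn f (size h) = P -> x = sigma h).
Proof.
move=> fol; split; last by apply: (fol h x [::]); rewrite cats1.
move=> h1 y h2 defh; apply: (fol h1 y (rcons h2 x)).
by rewrite defh rcons_cat rcons_cons.
Qed.

Lemma follows_rconsI f P sigma h x : follows f P sigma h ->
  (turn f (size h) = P -> x = sigma h) -> follows f P sigma (rcons h x).
Proof.
move=> fol folx h1 y h2; case/lastP: h2 => [|h2 z].
  by rewrite cats1 => /rcons_inj[<- <-].
by rewrite -rcons_cons -rcons_cat => /rcons_inj[/fol].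
Qed.

Lemma favors_wins f P : favors P (value f [::]) -> wins G s t f P.
Proof.
move=> v0.
(* Move to any successor whose value still favours [P]. The first default keeps [sigma] legal at
   histories already lost for [P]; [s] is returned only when nothing is left to select. Along a play
   that follows [sigma] the value favours [P] throughout. *)
pose sigma h :=
  if [pick x in unselected h | favors P (value f (rcons h x))] is Some x then x
  else odflt s [pick x in unselected h].
exists sigma; split=> [h _ /eqP U_neq0 _ | h [hist U0] fol].
  rewrite /sigma; case: pickP => [x /andP[] // | _].
  by case: pickP => [// | U0]; case/set0Pn: U_neq0 => x; rewrite [_ \in _]U0.
apply: value_complete => // {U0}.
elim/last_ind: h hist fol => // h x IH /history_rcons[hist xU].
case/follows_rcons=> fol defx; have {IH} vh := IH hist fol.
have [fP | fP] : turn f (size h) = P \/ turn f (size h) <> P.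
- by case: (turn f _); case: P {sigma v0 fol defx vh}; [left|right|right|left].
- rewrite (defx fP) /sigma; case: pickP => [y /andP[] // | none].
  have U_neq0 : unselected h != set0 by apply/set0Pn; exists x.
  case: (value_own_move U_neq0 fP vh) => y yU vy.
  by have:= none y; rewrite /= yU vy.
- exact: value_other_move.
Qed.

(** Playing the two strategies against each other produces one complete history that follows both,
    and it cannot be won by both players. *)
Lemma wins_excl f : wins G s t f Short -> wins G s t f Cut -> False.
Proof.
case=> sigma [legS winS] [tau [legT winT]].
suff [h [hc folS folT]] : exists h, [/\ complete G s t h,
    follows f Short sigma h & follows f Cut tau h].
  exact: winT hc folT (winS h hc folS).
have: history [::] /\ follows f Short sigma [::] /\ follows f Cut tau [::].
  by split; [split | split; case].
have: exists U, unselected [::] = U by eexists.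
case=> U; elim/set_proper_ind: U [::] => U IH h defU [hist [folS folT]].
have [U0 | U_neq0] := eqVneq U set0.
  by exists h; split=> //; split=> //; rewrite defU.
have step x : x \in U -> (turn f (size h) = Short -> x = sigma h) ->
    (turn f (size h) = Cut -> x = tau h) ->
    exists h, [/\ complete G s t h, follows f Short sigma h & follows f Cut tau h].
  move=> xU xS xT; apply: (IH (U :\ x)) (rcons h x) _ _; first exact: properD1.
    by rewrite unselected_rcons defU.
  split; first by apply/history_rcons; rewrite defU.
  by split; apply: follows_rconsI.
have Un : unselected h <> set0 by rewrite defU; apply/eqP.
case fh : (turn f (size h)); [apply: (step (sigma h)) | apply: (step (tau h))].
all: rewrite ?fh // -defU.
  exact: legS.
exact: legT.
Qed.

(** Determinacy: a value that does not favour [P] favours the opponent, who would then also have a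
    winning strategy, against [wins_excl]. Statements about strategies thus become statements about
    one boolean. *)
Lemma winsP f P : wins G s t f P <->
  favors P (short_wins linked f (nonterminals G s t) set0).
Proof.
have -> : short_wins linked f (nonterminals G s t) set0 = value f [::].
  by rewrite /value unselected0 shorted0.
split; last exact: favors_wins.
case: P => w; last first.
  by apply/negP => v; apply: (@wins_excl f) w; apply: favors_wins.
by apply/negPn/negP => v; apply: (wins_excl w); apply: favors_wins.
Qed.

End Histories.

(** * The short-cut and its reduction *)

Section ShortCut.
Variables (V : finType) (G : sgraph V) (s t a b : V).
Hypothesis hG : shannon_game G s t.
Implicit Types T : {set V}.
Hypothesis hab : short_cut G s t a b.

Let G' := cut_vertex (short_vertex G a) b.
Let N := nonterminals G s t.

(** This form hides which terminal [u] is the neighbour of [b]. The walk of length 2 from [b] to the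
    other terminal [w] passes through [u] or [a], the only neighbours of [b]; in the first case the
    terminals are adjacent. *)
Lemma short_cut_terminal : exists u w,
  [/\ [set u; w] = [set s; t], adj G b u, forall x, adj G b x -> x = u \/ x = a
    & adj G s t \/ adj G a w].
Proof.
case: hG => sG tG st; case: hab => aN bN ab deg2 hterm.
have [aT aG] : a \notin [set s; t] /\ a \in verts G by move: aN; rewrite in_setD; case/andP.
have nbr u : u \in [set s; t] -> adj G b u -> forall x, adj G b x -> x = u \/ x = a.
  move=> uT bu x bx; have ua : u != a by apply: contraNneq aT => <-.
  (* Two distinct neighbours exhaust a neighbourhood of size 2. *)
  have : [set u; a] == [set x in verts G | adj G b x].
    rewrite eqEcard -/(degree G b) deg2 cards2 ua andbT subUset !sub1set !inE.
    by rewrite aG bu (adj_sym G b a) ab !andbT; apply: (@adj_verts _ G u b); rewrite adj_sym.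
  move/eqP/setP/(_ x); rewrite !inE bx andbT.
  rewrite (@adj_verts _ G x b) 1?adj_sym //.
  by case/orP=> /eqP->; [left | right].
have dist u w : u \in [set s; t] -> adj G b u -> at_distance G b w 2 ->
    adj G u w \/ adj G a w.
  move=> uT bu [[q [pth lst sz]] _]; case: q => [|x [|y [|]]] //= in pth lst sz *.
  case/and3P: pth => bx xy _; rewrite lst in xy.
  by case: (nbr u uT bu x bx) => <-; [left | right].
case: hterm => -[bu /dist dst].
  exists s, t; split=> //; first by apply: nbr; rewrite ?set21.
  by apply: dst; rewrite ?set21.
exists t, s; split=> //; first by rewrite setUC.
  by apply: nbr; rewrite ?set22.
by rewrite (adj_sym G s t); apply: dst; rewrite ?set22.
Qed.

Lemma terminals_neq : [/\ a != s, a != t, b != s, b != t & a != b].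
Proof.
case: hab => aN bN ab _ _; move: aN bN; rewrite !inE !negb_or.
case/andP=> /andP[-> ->] _ /andP[/andP[-> ->] _]; split=> //.
by apply: contraTneq ab => ->; rewrite adj_irr.
Qed.

Lemma adj_reducedE x y : adj G' x y =
  [&& x != b, y != b, x != a, y != a, x != y
    & adj G x y || adj G a x && adj G a y].
Proof. by []. Qed.

Lemma nonterminals_reduced : nonterminals G' s t = N :\ a :\ b.
Proof.
by apply/setP=> x; rewrite !inE; do 3!case: (_ == _) => //=; rewrite ?andbF.
Qed.

(* When s and t are not adjacent, the map fixing everything but a and sending a
   to its terminal neighbour w turns walks of G into walks of G', since the
   neighbours of a form a clique of G'. *)
Lemma linked_shorted T : T \subset N :\ a :\ b ->
  linked G s t (a |: T) -> linked G' s t T.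
Proof.
move=> sT; case: terminals_neq => as_ at_ bs bt ab.
have sTab x : x \in T -> (x != a) && (x != b).
  by move/(subsetP sT); rewrite !inE => /and3P[-> ->].
case: short_cut_terminal => u [w [uwst _ _ [st | aw]]].
  move=> _; apply: connect1; rewrite inner_adjE adj_reducedE !inE !eqxx !orbT !andbT st /=.
  rewrite (eq_sym s b) bs (eq_sym t b) bt (eq_sym s a) as_ (eq_sym t a) at_ /=.
  by rewrite andbT; case: hG.
have wT : w \in [set s; t] by rewrite -uwst set22.
pose r x := if x == a then w else x.
have rs : r s = s by rewrite /r eq_sym (negPf as_).
have rt : r t = t by rewrite /r eq_sym (negPf at_).
have wab : (w != a) && (w != b).
  by move: wT; rewrite !inE => /orP[] /eqP->; rewrite ![_ == a]eq_sym ![_ == b]eq_sym ?as_ ?at_ ?bs ?bt.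
case/andP: wab => wa wb.
have nab x : x \in T :|: [set s; t] -> (x != a) && (x != b).
  rewrite !inE => /or3P[/sTab // | |] /eqP->;
  by rewrite ![_ == a]eq_sym ![_ == b]eq_sym ?as_ ?at_ ?bs ?bt.
have wI : w \in T :|: [set s; t] by rewrite in_setU wT orbT.
have inI x : x \in (a |: T) :|: [set s; t] -> x != a -> x \in T :|: [set s; t].
  by rewrite -setUA in_setU1 => /predU1P[-> | //]; rewrite eqxx.
have near x : adj G a x -> x \in T :|: [set s; t] -> connect (inner_adj G' s t T) w x.
  move=> ax xI; have [-> // | wx] := eqVneq w x; apply: connect1.
  case/andP: (nab _ xI) => xa xb.
  by rewrite inner_adjE adj_reducedE wa wb xa xb wx aw ax orbT wI xI.
move=> /(@connect_map _ _ (inner_adj G' s t T) r).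
rewrite rs rt; apply=> x y /and3P[xy xI yI].
rewrite /r; case: (eqVneq x a) => [xa | xa]; case: (eqVneq y a) => [ya | ya] //.
- by apply: near; [rewrite -xa | apply: inI].
- by rewrite connect_inner_sym; apply: near; [rewrite -ya adj_sym | apply: inI].
have xI' := inI x xI xa; have yI' := inI y yI ya.
case/andP: (nab _ xI') (nab _ yI') => _ xb /andP[_ yb].
apply: connect1; rewrite inner_adjE adj_reducedE xa ya xb yb xy xI' yI' !andbT.
by apply: contraTneq xy => ->; rewrite adj_irr.
Qed.

(** With [a] not shorted, [b] is a dead end whose only usable neighbour is the terminal [u]; sending
    [b] to [u] retracts every walk onto one avoiding the pair. *)
Lemma linked_cut T : T \subset N :\ a :\ b ->
  linked G s t (b |: T) -> linked G' s t T.
Proof.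
move=> sT; case: terminals_neq => as_ at_ bs bt ab.
case: short_cut_terminal => u [w [uwst bu nbr _]].
have uT : u \in [set s; t] by rewrite -uwst set21.
have aI : a \notin (b |: T) :|: [set s; t].
  rewrite !inE (negPf as_) (negPf at_) (negPf ab) !orbF.
  by apply/negP => /(subsetP sT); rewrite !inE eqxx andbF.
have nb x : x \in (b |: T) :|: [set s; t] -> adj G b x -> x = u.
  by move=> xI /nbr[// | xa]; rewrite -xa xI in aI.
have inI x : x \in (b |: T) :|: [set s; t] -> x != b -> x \in T :|: [set s; t].
  by rewrite -setUA in_setU1 => /predU1P[-> | //]; rewrite eqxx.
have na x : x \in (b |: T) :|: [set s; t] -> x != a by apply: contraTneq => ->.
pose r x := if x == b then u else x.
have rs : r s = s by rewrite /r eq_sym (negPf bs).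
have rt : r t = t by rewrite /r eq_sym (negPf bt).
move=> /(@connect_map _ _ (inner_adj G' s t T) r).
rewrite rs rt; apply=> x y /and3P[xy xI yI].
rewrite /r; case: (eqVneq x b) => [xb | xb]; case: (eqVneq y b) => [yb | yb] //.
- by rewrite (nb y) // -xb.
- by rewrite (nb x) // -yb adj_sym.
apply: connect1; rewrite inner_adjE adj_reducedE xb yb (na x) // (na y) // xy !inI // !andbT.
by apply: contraTneq xy => ->; rewrite adj_irr.
Qed.

(** An edge created by shorting [a] is replaced by two steps through [a], and no edge at [b] is ever
    used. The graph [H] is left general so as to cover both [G] and [G] with an edge at [b]
    deleted. *)
Lemma linked_unreduced H T :
  (forall x y, x != b -> y != b -> adj G x y -> adj H x y) ->
  linked G' s t T -> linked H s t (a |: T).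
Proof.
case: terminals_neq => _ _ _ _ ab sGH; apply: connect_sub => x y.
case/and3P=> xy xI yI; move: xy; rewrite adj_reducedE.
case/and3P=> xb yb /and4P[xa ya _ /orP[xy | /andP[ax ay]]].
  by apply: connect1; rewrite inner_adjE sGH // -setUA !in_setU1 xI yI !orbT.
apply: (@connect_trans _ _ a); apply: connect1.
  by rewrite inner_adjE sGH // 1?adj_sym // -setUA !in_setU1 xI eqxx !orbT.
by rewrite inner_adjE sGH // -setUA !in_setU1 yI eqxx !orbT.
Qed.

(** Unless the terminals are adjacent, the walk [u], [b], [a], [w] joins them. *)
Lemma linked_pair : linked G s t (a |: [set b]).
Proof.
case: short_cut_terminal => u [w [uwst bu _ [st | aw]]].
  by apply: connect1; rewrite inner_adjE st !inE !eqxx !orbT.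
have [_ _ ab _ _] := hab.
have uT : u \in [set s; t] by rewrite -uwst set21.
have wT : w \in [set s; t] by rewrite -uwst set22.
set e := inner_adj G s t (a |: [set b]).
have uw : connect e u w.
  apply: (@connect_trans _ _ b); first apply: connect1.
    by rewrite /e inner_adjE adj_sym bu in_setU uT !inE eqxx !orbT.
  apply: (@connect_trans _ _ a); apply: connect1.
    by rewrite /e inner_adjE adj_sym ab !inE !eqxx !orbT.
  by rewrite /e inner_adjE aw (in_setU w) wT !inE eqxx !orbT.
have: s \in [set u; w] by rewrite uwst set21.
have: t \in [set u; w] by rewrite uwst set22.
have [_ _ st] := hG.
rewrite /linked -/e !inE => /orP[] /eqP-> /orP[] /eqP-> //.
by rewrite connect_inner_sym.
Qed.

Lemma reduced_forward p :
  short_wins (linked G s t) p N set0 ->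
  short_wins (linked G' s t) p (N :\ a :\ b) set0.
Proof.
case: hab => aN bN _ _ _; case: terminals_neq => _ _ _ _ ab.
apply: short_wins_pairing => // T sT; rewrite !setU0 setUC.
  exact: linked_shorted.
exact: linked_cut.
Qed.

Lemma reduced_backward :
  short_wins (linked G' s t) Short (N :\ a :\ b) set0 ->
  short_wins (linked G s t) Short N set0.
Proof.
case: hab => aN bN _ _ _; case: terminals_neq => _ _ _ _ ab w'.
apply: (short_wins_take aN); rewrite setU0.
have bNa : b \in N :\ a by rewrite in_setD1 eq_sym ab.
apply/short_wins_CutP=> [|y yNa]; first by apply/set0Pn; exists b.
have [-> | yb] := eqVneq y b.
  apply: short_wins_sub w' => T _; rewrite setU0 setUC.
  exact: linked_unreduced.
(* Cut has spared [b]: by taking it Short completes his link, whatever happens afterwards. *)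
apply: (@short_wins_take _ _ _ _ b); first by rewrite in_setD1 eq_sym yb.
apply: short_wins_won; first exact: linked_up.
by rewrite setUC; apply: linked_pair.
Qed.

(** After opening with [a], Short plays as second player in the reduced game, with [b] as an extra
    free vertex. The connection he obtains uses no edge at [b], so the edge from [b] to its terminal
    can be deleted beforehand. *)
Lemma reduced_strong_redundant_edge :
  short_wins (linked G' s t) Cut (N :\ a :\ b) set0 ->
  exists2 u, adj G b u &
    short_wins (linked (del_edge G b u) s t) Short N set0.
Proof.
case: hab => aN bN _ _ _; case: terminals_neq => _ _ _ _ ab w'.
case: short_cut_terminal => u [_ [_ bu _ _]]; exists u => //.
apply: (short_wins_take aN); rewrite setU0.
have bNa : b \in N :\ a by rewrite in_setD1 eq_sym ab.
rewrite -(setD1K bNa); apply: short_wins_extra_vertex.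
- exact: linked_up.
- by rewrite setD11.
apply: short_wins_sub w' => T _; rewrite setU0 setUC.
apply: linked_unreduced => x y xb yb xy; apply/andP; split=> //.
apply: contra_neqN (xb) => /eqP/setP/(_ b).
by rewrite !inE eqxx !(eq_sym b) (negPf yb) orbF => /eqP.
Qed.

End ShortCut.

Theorem theorem6 (V : finType) (G : sgraph V) (s t a b : V) (first : player)
  (hG : shannon_game G s t)
  (hab : short_cut G s t a b)
  (hyp : (minimal_weak_link G s t \/ minimal_strong_link G s t)
      \/ (weak_link G s t /\ first = Short)
      \/ (exists P : player, wins G s t (opponent P) P)) :
  forall P : player,
    wins G s t first P <-> wins (cut_vertex (short_vertex G a) b) s t first P.
Proof.
move=> P; have [_ _ st] := hG.
(* By determinacy, equality of the two boolean values settles both choices of [P] at once. *)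
suff eq_value : short_wins (linked G s t) first (nonterminals G s t) set0 =
    short_wins (linked (cut_vertex (short_vertex G a) b) s t) first
      (nonterminals G s t :\ a :\ b) set0.
  apply: (iff_trans (winsP G st first P)); rewrite eq_value.
  by rewrite -nonterminals_reduced; apply: iff_sym; apply: winsP.
apply/idP/idP; first exact: reduced_forward.
case: first hyp => hyp; first exact: reduced_backward.
move=> w'.
have wG : short_wins (linked G s t) Short (nonterminals G s t) set0.
  by apply: (reduced_backward hG hab); apply: (short_wins_first _ w'); apply: linked_up.
(* Cut moves first and the reduction is strong. A minimal weak link contradicts the redundant edge;
   a minimal strong link, or Short winning as second player, is the goal itself; Cut winning as
   second player contradicts [wG]. *)
case: hyp => [[[_ minG] | [strong _]] | [[_ //] | [[] /winsP]]].
- have [u bu /(winsP _ st _ Short) w] := reduced_strong_redundant_edge hG hab w'.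
  by case: (minG _ _ bu).
- exact/(winsP _ st _ Short).
- by move=> /(_ st).
- by move=> /(_ st) /=; rewrite wG.
Qed.
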